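(* For every integer $n\ge 3$, \[\sum_{i=0}^{\lfloor n/3\rfloor-1}\prod_{j=1}^i\frac{-\binom{n-3j}{3}}{\binom{n}{3}-\binom{n-3j}{3}} =\Bigl\lfloor\frac{n}{3}\Bigr\rfloor\cdot\frac{\displaystyle\prod_{\substack{n+1\le j\le \lfloor3n/2\rfloor-2\\3\nmid j}}c_j}{\displaystyle\prod_{\substack{3\le j\le n-3\\3\mid j}}c_j},\] where for each integer $j$, \[c_j=j^2 + (3-3n)j + 3n^2-6n+2\quad\Bigl(=\tfrac{6}{j}\bigl(\tbinom{n}{3}-\tbinom{n-j}{3}\bigr)\text{ for } j\neq 0\Bigr).\]
   Context: Empty products are equal to $1$. Here $\binom{x}{3}=x(x-1)(x-2)/6$ for any integer $x$. (The left-hand side equals the probability that a uniformly random vertex ordering of the line graph of the complete $3$-uniform hypergraph on $n$ vertices is successive, i.e. every initial segment induces a connected subgraph; this interpretation is not needed for the identity.) *)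

(* Defs.v *)
From mathcomp Require Import all_boot all_order all_algebra.
From mathcomp Require Import ring.

Set Implicit Arguments.
Unset Strict Implicit.
Unset Printing Implicit Defensive.

Import Order.TTheory GRing.Theory Num.Theory.
Local Open Scope ring_scope.

Definition binom3 (x : int) : rat :=
  x%:Q * (x%:Q - 1) * (x%:Q - 2) / 6.

Definition c (n j : int) : int :=
  j ^+ 2 + (3 - 3 * n) * j + 3 * n ^+ 2 - 6 * n + 2.

Lemma binom3_bin (m : nat) : binom3 m%:Z = ('C(m, 3))%:R.
Proof.
rewrite /binom3; case: m => [|[|m]] /=.
- by rewrite !mul0r.
- by rewrite /= subrr mulr0 !mul0r.
have H : ('C(m.+2, 3) * 6 = m.+2 * m.+1 * m)%N.
  by rewrite -[6%N]/(3`!) bin_ffact !ffactnS ffactn0 muln1 mulnA.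
have -> : ('C(m.+2, 3))%:R = (m.+2 * m.+1 * m)%N%:R / 6 :> rat.
  by rewrite -H natrM mulfK.
rewrite !natrM -!pmulrn -(natr1 m.+1) -(natr1 m); congr (_ / _).
by ring.
Qed.

Lemma cE (n j : int) : j != 0 ->
  (c n j)%:Q = 6 / j%:Q * (binom3 n - binom3 (n - j)).
Proof.
move=> j0; have j0' : j%:Q != 0 by rewrite intr_eq0.
rewrite /c /binom3 !(rmorphD, rmorphB, rmorphM, rmorphXn) /=.
by field.
Qed.

(* Main.v *)
Require Import Defs.
From mathcomp Require Import all_boot all_order all_algebra.
From mathcomp Require Import ring lra zify.

Set Implicit Arguments.
Unset Strict Implicit.
Unset Printing Implicit Defensive.

Import Order.TTheory GRing.Theory Num.Theory.
Local Open Scope ring_scope.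

(* Put ff x = x (x-1) (x-2), n = 3m + r with r < 3, z = ff n. The power series
   f_r = sum_l a_l x^(3l+r) solving (x^3 - 1) y''' = z y is a polynomial which
   vanishes at 1, and the left-hand side is, up to an explicit factor, f_r'(1).
   The Wronskian of f_r and of the solution f_s with s <> r solves the adjoint
   equation (x^3 - 1) y''' = - z y, hence is (s - r) g_t, where g_t is the adjoint
   solution starting at x^t, t = r + s - 1. At x = 1 this reads
   (s - r) g_t(1) = - f_r'(1) f_s(1). The partial sums of such series at 1
   telescope into products, so f_s(1) and g_t(1) are infinite products; since
   both involve the same quadratic c_j, their quotient collapses to a finite
   product, and c_j = c_(3n-3-j) brings it to the stated form. *)

(** * The series and their Wronskian *)

Definition ff (x : rat) : rat := x * (x - 1) * (x - 2).

Definition expo (r l : nat) : rat := 3 * l%:R + r%:R.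

(* The coefficient of x^(expo r l) in f_r is coef r z l, and psum r z L is the sum
   of the coefficients with l <= L (lemma sum_coef). *)
Definition psum (r : nat) (z : rat) (L : nat) : rat :=
  \prod_(1 <= j < L.+1) (1 - z / ff (expo r j)).

Definition coef (r : nat) (z : rat) (l : nat) : rat :=
  if l is l'.+1 then psum r z l - psum r z l' else 1.

Arguments coef : simpl never.

Lemma expoS r l : expo r l.+1 = expo r l + 3.
Proof. by rewrite /expo -natr1; ring. Qed.

Lemma expo0 r : expo r 0 = r%:R.
Proof. by rewrite /expo mulr0 add0r. Qed.

Lemma ff_small r : (r < 3)%N -> ff r%:R = 0.
Proof. by case: r => [|[|[|//]]] _; rewrite /ff; ring. Qed.

Lemma expo_ge3 r l : (0 < l)%N -> 3 <= expo r l.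
Proof.
by case: l => // l _; rewrite expoS lerDr /expo addr_ge0 // mulr_ge0.
Qed.

(** The true growth is cubic; a quadratic lower bound is enough to make both [z / ff (expo r l)] and
    [l] times it tend to 0. *)
Lemma ff_expo_ge r l : (0 < l)%N -> l%:R ^+ 2 <= ff (expo r l).
Proof.
move=> l0; have l1 : 1 <= l%:R :> rat by rewrite ler1n.
set x := expo r l; have hx : 3 * l%:R <= x by rewrite lerDl.
have le1 : l%:R ^+ 2 <= (x - 2) ^+ 2.
  by rewrite !expr2 ler_pM //; lra.
apply: le_trans le1 _; rewrite -subr_ge0.
have -> : ff x - (x - 2) ^+ 2 = (x - 2) * ((x - 1) ^+ 2 + 1).
  by rewrite /ff; ring.
have h1 := sqr_ge0 (x - 1); by rewrite mulr_ge0 //; lra.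
Qed.

Lemma ff_expo_gt0 r l : (0 < l)%N -> 0 < ff (expo r l).
Proof.
move=> /(expo_ge3 r) h; rewrite /ff.
by rewrite !mulr_gt0 //; lra.
Qed.

Lemma ff_expo_neq0 r l : (0 < l)%N -> ff (expo r l) != 0.
Proof. by move=> l0; rewrite gt_eqF // ff_expo_gt0. Qed.

Lemma psum0 r z : psum r z 0 = 1.
Proof. by rewrite /psum big_geq. Qed.

Lemma psumS r z L : psum r z L.+1 = psum r z L * (1 - z / ff (expo r L.+1)).
Proof. by rewrite /psum big_nat_recr. Qed.

Lemma coef_psum r z l : coef r z l.+1 = - (z / ff (expo r l.+1)) * psum r z l.
Proof. by rewrite /coef psumS; ring. Qed.

Lemma sum_coef r z L : \sum_(l < L.+1) coef r z l = psum r z L.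
Proof.
elim: L => [|L IH]; first by rewrite big_ord1 psum0.
by rewrite big_ord_recr /= IH /coef; ring.
Qed.

(** Comparing coefficients of x^(expo r l) in (x^3 - 1) y''' = z y. At l = 0 the term [ff r]
    vanishes, so the series may start at x^r. *)
Lemma coefS r z l : (r < 3)%N ->
  ff (expo r l.+1) * coef r z l.+1 = (ff (expo r l) - z) * coef r z l.
Proof.
move=> r3; have nz1 := @ff_expo_neq0 r l.+1 isT.
rewrite coef_psum; case: l nz1 => [|l] nz1.
  by rewrite psum0 /coef expo0 ff_small //; field.
have nz := @ff_expo_neq0 r l.+1 isT.
rewrite coef_psum psumS; field.
by rewrite nz nz1.
Qed.

Lemma coef_uniq t z (D : nat -> rat) : (t < 3)%N ->
  (forall l, ff (expo t l.+1) * D l.+1 = (ff (expo t l) - z) * D l) ->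
  forall l, D l = D 0%N * coef t z l.
Proof.
move=> t3 HD; elim=> [|l IH]; first by rewrite mulr1.
apply: (mulfI (@ff_expo_neq0 t l.+1 isT)).
by rewrite HD mulrCA coefS // IH; ring.
Qed.

Section Wronskian.
Variables (r s t : nat) (z : rat).
Hypotheses (r3 : (r < 3)%N) (s3 : (s < 3)%N) (t3 : (t < 3)%N).
Hypothesis rst : (r + s = t.+1)%N.

(** A weight w encodes a bilinear differential expression in f_r and f_s: the pair x^a, x^b is
    counted with factor w a b. All pairs at index L have a + b = 3L + r + s, so w matters only on
    that line. *)
Let conv (w : rat -> rat -> rat) (L : nat) : rat :=
  \sum_(l < L.+1)
     w (expo r l) (expo s (L - l)) * coef r z l * coef s z (L - l).

Let eq_conv (w1 w2 : rat -> rat -> rat) L :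
  (forall a b, a + b = expo t L + 1 -> w1 a b = w2 a b) ->
  conv w1 L = conv w2 L.
Proof.
move=> H; apply: eq_bigr => l _; rewrite H //.
rewrite /expo natrB; last by rewrite -ltnS ltn_ord.
have -> : (r%:R : rat) = t%:R + 1 - s%:R by rewrite natr1 -rst natrD; ring.
by ring.
Qed.

Let convB (w1 w2 : rat -> rat -> rat) L :
  conv (fun a b => w1 a b - w2 a b) L = conv w1 L - conv w2 L.
Proof. by rewrite /conv -sumrB; apply: eq_bigr => l _; ring. Qed.

Let convZ k (w : rat -> rat -> rat) L : conv (fun a b => k * w a b) L = k * conv w L.
Proof. by rewrite /conv mulr_sumr; apply: eq_bigr => l _; ring. Qed.

(** The recurrence [coefS] trades [ff b] at index k + 1 for [ff b - z] at index k. The boundary term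
    has b = s, where [ff] vanishes. *)
Let conv_shiftr (w : rat -> rat -> rat) L :
  conv (fun a b => w a b * ff b) L.+1
  = conv (fun a b => w a (b + 3) * (ff b - z)) L.
Proof.
rewrite /conv big_ord_recr /= subnn expo0 (ff_small s3) mulr0 !mul0r addr0.
apply: eq_bigr => l _; rewrite subSn; last by rewrite -ltnS.
set k := (L - l)%N; have := coefS z k s3; rewrite -expoS.
move: (coef s z k.+1) (coef s z k) (ff (expo s k.+1)) => b1 b0 f1 E.
transitivity (w (expo r l) (expo s k.+1) * coef r z l * (f1 * b1)); first by ring.
by rewrite E; ring.
Qed.

Let conv_shiftl (w : rat -> rat -> rat) L :
  conv (fun a b => w a b * ff a) L.+1
  = conv (fun a b => w (a + 3) b * (ff a - z)) L.
Proof.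
rewrite /conv big_ord_recl /= subn0 expo0 (ff_small r3) mulr0 !mul0r add0r.
apply: eq_bigr => l _; rewrite /bump /= add1n subSS.
have := coefS z l r3; rewrite -expoS.
move: (coef r z l.+1) (coef r z l) (ff (expo r l.+1)) => b1 b0 f1 E.
transitivity (w (expo r l.+1) (expo s (L - l)) * coef s z (L - l) * (f1 * b1)).
  by ring.
by rewrite E; ring.
Qed.

(* The coefficients of f g''' - f''' g, which vanishes since f and g solve the
   same equation y''' = z y / (x^3 - 1). *)
Let conv_ff L : conv (fun a b => 1 * ff b - 1 * ff a) L = 0.
Proof.
elim: L => [|L IH].
  by rewrite /conv big_ord1 !expo0 !ff_small // !mulr0 subrr !mul0r.
rewrite convB conv_shiftr conv_shiftl -convB -[RHS]IH.
by apply: eq_conv => a b _; ring.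
Qed.

(* The coefficient of x^(expo t L) in f_r f_s' - f_r' f_s. *)
Definition wronskian (L : nat) : rat :=
  \sum_(l < L.+1)
     (expo s (L - l) - expo r l) * coef r z l * coef s z (L - l).

(** The adjoint equation for W = f g' - f' g, based on W''' = f g'''' + 2 f' g''' - 2 f''' g' -
    f'''' g: every term contains a derivative of order at least 3, to which the equation of f or g
    applies. *)
Lemma wronskian_rec L :
  ff (expo t L.+1) * wronskian L.+1 = (ff (expo t L) + z) * wronskian L.
Proof.
have conv_w k : wronskian k = conv (fun a b => b - a) k by [].
pose e := expo t L.+1.
transitivity (conv (fun a b => (a + (e - 2)) * ff b - (b + (e - 2)) * ff a) L.+1).
  rewrite conv_w -convZ; apply: eq_conv => a b.
  rewrite -/e => ab; have -> : e = a + b - 1 by rewrite ab; ring.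
  by rewrite /ff; ring.
rewrite convB conv_shiftr conv_shiftl -convB.
(* After the shift e = a + b + 2, which is 3 more than in the same expansion at L; the excess 3 (ff
   b - ff a) sums to 0 by [conv_ff]. *)
rewrite conv_w -convZ -[LHS]subr0 -(mulr0 3) -(conv_ff L) -convZ -convB.
apply: eq_conv => a b ab.
rewrite /e expoS; have -> : expo t L = a + b - 1 by rewrite ab; ring.
by rewrite /ff; ring.
Qed.

Lemma sum_wronskian L :
  \sum_(i < L.+1) wronskian i = (s%:R - r%:R) * psum t (- z) L.
Proof.
rewrite -sum_coef mulr_sumr; apply: eq_bigr => i _.
rewrite (@coef_uniq t (- z) wronskian) //; last first.
  by move=> l; rewrite wronskian_rec opprK.
by rewrite /wronskian big_ord1 !expo0 /= !mulr1.
Qed.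

(** The triangle l + k <= L is summed with l outermost, since only finitely many l contribute once
    f_r is a polynomial. *)
Lemma sum_wronskian_conv L :
  \sum_(i < L.+1) wronskian i
  = \sum_(l < L.+1) coef r z l *
      \sum_(k < (L - l).+1) (expo s k - expo r l) * coef s z k.
Proof.
elim: L => [|L IH].
  by rewrite /wronskian !big_ord1 /=; ring.
rewrite [LHS]big_ord_recr IH /= /wronskian [X in _ + X]big_ord_recr /=.
rewrite [RHS]big_ord_recr /= addrA subnn; congr (_ + _); last by rewrite big_ord1; ring.
rewrite -big_split /=; apply: eq_bigr => l _.
rewrite subSn; last by rewrite -ltnS.
by rewrite [in RHS]big_ord_recr /=; ring.
Qed.

End Wronskian.

(** * Limits of rational sequences *)

(* Convergence at rate O(1/k), all that is needed here and stable under products. *)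
Definition tends (u : nat -> rat) (a : rat) : Prop :=
  exists C, forall k, (0 < k)%N -> `|u k - a| * k%:R <= C.

Lemma tends_ext u v a :
  (forall k, (0 < k)%N -> u k = v k) -> tends u a -> tends v a.
Proof. by move=> E [C H]; exists C => k k0; rewrite -E // H. Qed.

Lemma tends_cst a : tends (fun=> a) a.
Proof. by exists 0 => k _; rewrite subrr normr0 mul0r. Qed.

Lemma tendsD u v a b : tends u a -> tends v b -> tends (fun k => u k + v k) (a + b).
Proof.
move=> [C Hu] [D Hv]; exists (C + D) => k k0.
apply: le_trans (lerD (Hu k k0) (Hv k k0)); rewrite -mulrDl ler_wpM2r //.
by rewrite opprD addrACA ler_normD.
Qed.

Lemma tendsM u v a b : tends u a -> tends v b -> tends (fun k => u k * v k) (a * b).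
Proof.
move=> [C Hu] [D Hv]; exists (C * D + `|a| * D + `|b| * C) => k k0.
have k1 : 1 <= k%:R :> rat by rewrite ler1n.
have Hu0 : `|u k - a| <= C.
  by apply: le_trans (Hu k k0); rewrite ler_peMr.
have -> : u k * v k - a * b = (u k - a) * (v k - b) + a * (v k - b) + b * (u k - a).
  by ring.
apply: le_trans (_ : (`|u k - a| * `|v k - b| + `|a| * `|v k - b|
                      + `|b| * `|u k - a|) * k%:R <= _).
  rewrite ler_wpM2r //; apply: le_trans (ler_normD _ _) _.
  rewrite [`|b * _|]normrM lerD2r.
  by apply: le_trans (ler_normD _ _) _; rewrite !normrM.
rewrite !mulrDl -!mulrA !lerD //.
- by rewrite ler_pM // ?mulr_ge0 // Hv.
- by rewrite ler_wpM2l // Hv.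
- by rewrite ler_wpM2l // Hu.
Qed.

Lemma tends_sum n (u : nat -> nat -> rat) (a : nat -> rat) :
  (forall i, (i < n)%N -> tends (u i) (a i)) ->
  tends (fun k => \sum_(i < n) u i k) (\sum_(i < n) a i).
Proof.
elim: n => [|n IH] H.
  by rewrite big_ord0; apply: tends_ext (tends_cst 0) => k _; rewrite big_ord0.
rewrite big_ord_recr /=.
apply: tends_ext (tendsD (IH _) (H n _)) => // [k _|i i_n].
  by rewrite big_ord_recr.
by apply: H; apply: ltnW.
Qed.

Lemma tends_prod1 n (u : nat -> nat -> rat) :
  (forall i, (i < n)%N -> tends (u i) 1) ->
  tends (fun k => \prod_(i < n) u i k) 1.
Proof.
elim: n => [|n IH] H.
  by apply: tends_ext (tends_cst 1) => k _; rewrite big_ord0.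
rewrite -[1]mulr1; apply: tends_ext (tendsM (IH _) (H n _)) => // [k _|i i_n].
  by rewrite big_ord_recr.
by apply: H; apply: ltnW.
Qed.

Lemma tends_uniq u a b : tends u a -> tends u b -> a = b.
Proof.
move=> [C Hu] [D Hv]; apply/eqP; rewrite -subr_eq0 -normr_le0 leNgt.
apply/negP => ab0; set d := `|a - b| in ab0.
pose k := (Num.bound ((C + D) / d)).+1.
have CD0 : 0 <= C + D.
  by rewrite addr_ge0 //; [apply: le_trans (Hu 1%N isT)|apply: le_trans (Hv 1%N isT)];
    rewrite mulr_ge0.
have := archi_boundP (divr_ge0 CD0 (ltW ab0)).
rewrite ltr_pdivrMr // => lt1.
have le1 : d * k%:R <= C + D.
  apply: le_trans (lerD (Hu k isT) (Hv k isT)); rewrite -mulrDl ler_wpM2r //.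
  rewrite /d (_ : a - b = (u k - b) - (u k - a)); last by ring.
  by rewrite [leRHS]addrC ler_normB.
have : d * k%:R < d * (Num.bound ((C + D) / d))%:R.
  by apply: le_lt_trans le1 _; rewrite mulrC.
by rewrite ltr_pM2l // ltr_nat ltnNge leqnSn.
Qed.

(** * Asymptotics of the partial sums at x = 1 *)

Lemma tends_ff r z j : tends (fun k => 1 - z / ff (expo r (k + j.+1))) 1.
Proof.
exists `|z| => k k0; set f := ff _.
have f0 : 0 < f by apply: ff_expo_gt0; rewrite addnS.
have kf : k%:R <= f.
  apply: le_trans (ff_expo_ge r _); last by rewrite addnS.
  by rewrite -natrX ler_nat; nia.
rewrite (_ : 1 - _ - 1 = - (z / f)); last by ring.
by rewrite normrN normrM normfV (gtr0_norm f0) mulrAC ler_pdivrMr // ler_wpM2l.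
Qed.

Lemma tends_natM_ff r z j :
  tends (fun k => (k + j.+1)%:R * (z / ff (expo r (k + j.+1)))) 0.
Proof.
exists `|z| => k k0; set f := ff _.
have f0 : 0 < f by apply: ff_expo_gt0; rewrite addnS.
have kf : (k + j.+1)%:R * k%:R <= f.
  apply: le_trans (ff_expo_ge r _); last by rewrite addnS.
  by rewrite -natrX -natrM ler_nat; nia.
rewrite subr0 !normrM normfV normr_nat (gtr0_norm f0).
rewrite mulrCA -!mulrA ler_piMr //.
by rewrite mulrCA mulrC ler_pdivrMr // mul1r.
Qed.

(** Summation by parts. When [psum r z m] is 0 it gives f_r'(1) = -3 times the sum of the
    [psum r z l] with l < m. *)
Lemma sum_nat_coef r z m :
  \sum_(l < m.+1) l%:R * coef r z l + \sum_(l < m) psum r z l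
  = m%:R * psum r z m.
Proof.
elim: m => [|m IH]; first by rewrite big_ord1 big_ord0 mul0r addr0 mul0r.
rewrite big_ord_recr [X in _ + X]big_ord_recr /= addrACA IH /coef -natr1.
by ring.
Qed.

Lemma psum_eq0 r z m l : psum r z m = 0 -> (m <= l)%N -> psum r z l = 0.
Proof.
move=> E; elim: l => [|l IH]; first by rewrite leqn0 => /eqP <-.
by rewrite leq_eqVlt => /predU1P[<- //|/IH]; rewrite psumS => ->; rewrite mul0r.
Qed.

Lemma psum_ratio s z k i : psum s z k != 0 ->
  psum s z (k + i) / psum s z k
  = \prod_(j < i) (1 - z / ff (expo s (k + j.+1))).
Proof.
move=> nz; elim: i => [|i IH]; first by rewrite addn0 divff // big_ord0.
by rewrite big_ord_recr /= -IH addnS psumS; ring.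
Qed.

Lemma tends_psum_ratio s z i : (forall k, psum s z k != 0) ->
  tends (fun k => psum s z (k + i) / psum s z k) 1.
Proof.
move=> nz; apply: tends_ext (fun k _ => esym (psum_ratio i (nz k))) _.
apply: (@tends_prod1 i (fun j k => 1 - z / ff (expo s (k + j.+1)))) => j _.
exact: tends_ff.
Qed.

Lemma tends_coef_ratio s z j : (forall k, psum s z k != 0) ->
  tends (fun k => (k + j.+1)%:R * coef s z (k + j.+1) / psum s z k) 0.
Proof.
move=> nz; rewrite -(mul0r 1).
apply: tends_ext (tendsM (tends_natM_ff s (- z) j) (tends_psum_ratio j nz)).
by move=> k _; rewrite addnS coef_psum; ring.
Qed.

(** The middle sum depends on neither l nor i, so it will cancel against f_r(1) = 0 and its limit is
    never examined. The last sum becomes negligible after division by [psum s z k]. *)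
Lemma sum_expo_coef r s z l k i :
  \sum_(h < (k + i).+1) (expo s h - expo r l) * coef s z h
  = (s%:R - expo r l) * psum s z (k + i)
    + 3 * \sum_(h < k.+1) h%:R * coef s z h
    + 3 * \sum_(j < i) (k + j.+1)%:R * coef s z (k + j.+1).
Proof.
rewrite -sum_coef -addrA -mulrDr.
have -> : \sum_(h < k.+1) h%:R * coef s z h
    + \sum_(j < i) (k + j.+1)%:R * coef s z (k + j.+1)
    = \sum_(h < (k + i).+1) h%:R * coef s z h.
  elim: i => [|i IH]; first by rewrite big_ord0 addr0 addn0.
  by rewrite [X in _ + X]big_ord_recr /= addrA IH addnS [RHS]big_ord_recr.
rewrite !mulr_sumr -big_split; apply: eq_bigr => h _ /=.
by rewrite /expo; ring.
Qed.

(* The Wronskian of f_r and f_s at 1, when f_r(1) = 0, is -f_r'(1) f_s(1); the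
   values at 1 of the non-terminating series are limits of partial sums. *)
Lemma sum_psum_limit r s t z m q :
  (r < 3)%N -> (s < 3)%N -> (t < 3)%N -> (r + s = t.+1)%N ->
  psum r z m = 0 -> (forall k, psum s z k != 0) ->
  (forall k, psum t (- z) k != 0) ->
  tends (fun k => psum t (- z) k / psum s z k) q ->
  (s%:R - r%:R) * q = 3 * \sum_(l < m) psum r z l.
Proof.
move=> r3 s3 t3 rst z_m nz nzt lim_q.
(* The l-th term of the summed Wronskian up to index k + m, divided by [psum s z k], without the
   part common to all l. *)
pose T l k : rat := coef r z l * ((s%:R - expo r l) * (psum s z (k + (m - l)) / psum s z k)
    + 3 * \sum_(j < m - l) (k + j.+1)%:R * coef s z (k + j.+1) / psum s z k).
have sum_a : \sum_(l < m.+1) coef r z l = 0 by rewrite sum_coef.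
have key k : (s%:R - r%:R) * psum t (- z) (k + m) / psum s z k
    = \sum_(l < m.+1) T l k.
  rewrite -(sum_wronskian z r3 s3 t3 rst) sum_wronskian_conv.
  have -> : (k + m).+1 = (m.+1 + k)%N by rewrite addnC.
  rewrite big_split_ord /= [X in _ + X]big1 ?addr0; last first.
    move=> i _; rewrite addSn /coef !(psum_eq0 z_m) ?subrr ?mul0r //; lia.
  set V := \sum_(h < k.+1) h%:R * coef s z h.
  transitivity (\sum_(l < m.+1) (T l k + coef r z l * (3 * V / psum s z k))).
    rewrite mulr_suml; apply: eq_bigr => l _.
    have lm : (l <= m)%N by rewrite -ltnS.
    rewrite -addnBA //.
    by rewrite sum_expo_coef -/V /T -mulr_suml; ring.
  by rewrite big_split /= -mulr_suml sum_a mul0r addr0.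
have limL : tends (fun k => (s%:R - r%:R) * psum t (- z) (k + m) / psum s z k)
    ((s%:R - r%:R) * q).
  rewrite -[q]mulr1 mulrA.
  apply: tends_ext (tendsM (tendsM (tends_cst _) lim_q) (tends_psum_ratio m nzt)).
  by move=> k _; field; rewrite nz nzt.
have limR : tends (fun k => \sum_(l < m.+1) T l k)
    (\sum_(l < m.+1) coef r z l * ((s%:R - expo r l) * 1 + 3 * 0)).
  apply: (@tends_sum m.+1 T (fun l => coef r z l * ((s%:R - expo r l) * 1 + 3 * 0))).
  move=> l _; rewrite /T; apply: tendsM; first exact: tends_cst.
  apply: tendsD; apply: tendsM; [exact: tends_cst|exact: tends_psum_ratio
    |exact: tends_cst|].
  have := @tends_sum (m - l) _ _ (fun j _ => tends_coef_ratio j nz).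
  by rewrite [X in tends _ X]big1.
have -> : (s%:R - r%:R) * q
  = \sum_(l < m.+1) coef r z l * ((s%:R - expo r l) * 1 + 3 * 0).
  by apply: tends_uniq limL _; apply: tends_ext limR.
transitivity ((s%:R - r%:R) * \sum_(l < m.+1) coef r z l
              - 3 * \sum_(l < m.+1) l%:R * coef r z l).
  by rewrite !mulr_sumr -sumrB; apply: eq_bigr => l _; rewrite /expo; ring.
have := sum_nat_coef r z m; rewrite z_m sum_a.
by move/eqP; rewrite mulr0 addr_eq0 => /eqP ->; ring.
Qed.

(** * Evaluation of the infinite products *)

Definition cq (x y : rat) : rat := y ^+ 2 + (3 - 3 * x) * y + 3 * x ^+ 2 - 6 * x + 2.

Lemma cqE (n j : int) : (c n j)%:Q = cq n%:Q j%:Q.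
Proof. by rewrite /c /cq !(rmorphD, rmorphB, rmorphM, rmorphXn); ring. Qed.

Lemma cq_gt0 (x y : rat) : 3 <= x -> 0 < cq x y.
Proof.
move=> x3; have h := sqr_ge0 (2 * y + 3 - 3 * x).
have h2 : 0 <= (x - 3) ^+ 2 by apply: sqr_ge0.
suff : 0 < 4 * cq x y by lra.
have -> : 4 * cq x y = (2 * y + 3 - 3 * x) ^+ 2 + 3 * (x - 3) ^+ 2 + 12 * (x - 3) + 8.
  by rewrite /cq; ring.
by lra.
Qed.

Lemma cq_sym (x y : rat) : cq x (3 * x - 3 - y) = cq x y.
Proof. by rewrite /cq; ring. Qed.

(** [ff] is odd about 1, so the sum vanishes at y = 2 - x and a linear factor splits off. *)
Lemma ffD (x y : rat) : ff x + ff y = (x + y - 2) * cq x (x + y - 2).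
Proof. by rewrite /ff /cq; ring. Qed.

(** The natural cofactor is [cq x (x - y)]. It is written at the reflected point so that its
    argument grows with y, as in [ffD]. *)
Lemma ffB (x y : rat) : ff y - ff x = (y - x) * cq x (2 * x - 3 + y).
Proof. by rewrite /ff /cq; ring. Qed.

(** Numerator and denominator both have leading term 9 k^2 in k, so their difference is linear in k,
    while the denominator is at least k^2. *)
Lemma tends_quad (x a1 a2 b : rat) : 2 <= b ->
  tends (fun k => (3 * k%:R + a1) * (3 * k%:R + a2) / cq x (x + (3 * k%:R + b) - 1)) 1.
Proof.
move=> b2; pose al := 3 * (a1 + a2) - 6 * b + 3 * (x - 1).
pose be := a1 * a2 - b ^+ 2 + (x - 1) * b - (x - 1) ^+ 2 + 1.
exists (`|al| + `|be|) => k k0; set p := (3 * _ + a1) * _; set d := cq _ _.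
have k1 : 1 <= k%:R :> rat by rewrite ler1n.
have pd : p - d = al * k%:R + be by rewrite /p /d /cq /al /be; ring.
have dk : k%:R ^+ 2 <= d.
  have -> : d = (x - 1 - (3 * k%:R + b) / 2) ^+ 2 + 3 / 4 * (3 * k%:R + b) ^+ 2 - 1.
    by rewrite /d /cq; field.
  have h1 := sqr_ge0 (x - 1 - (3 * k%:R + b) / 2).
  have h2 : (3 * k%:R + 2) ^+ 2 <= (3 * k%:R + b) ^+ 2 by rewrite !expr2 ler_pM //; lra.
  by move: h1 h2; set u := _ ^+ 2; set v := (_ + b) ^+ 2 => h1 h2; nra.
have d0 : 0 < d by apply: lt_le_trans dk; rewrite exprn_gt0 // ltr0n.
have -> : p / d - 1 = (p - d) / d by field; rewrite gt_eqF.
rewrite normrM normfV (gtr0_norm d0) mulrAC ler_pdivrMr // pd.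
apply: le_trans (_ : (`|al| + `|be|) * k%:R ^+ 2 <= _); last first.
  by rewrite ler_wpM2l // addr_ge0.
rewrite expr2 mulrA ler_wpM2r //; apply: le_trans (ler_normD _ _) _.
by rewrite normrM normr_nat mulrDl lerD2l ler_peMr.
Qed.

(** The two windows of m points differ only at their ends. *)
Lemma prod_shiftl (f : rat -> rat) x m :
  (\prod_(i < m) f (x + 1 + i%:R)) * f x = (\prod_(i < m) f (x + i%:R)) * f (x + m%:R).
Proof.
elim: m => [|m IH]; first by rewrite !big_ord0 addr0.
rewrite !big_ord_recr /= mulrAC IH -natr1; congr (_ * f _).
by ring.
Qed.

Lemma prod_shiftr (f : rat -> rat) x m :
  (\prod_(i < m) f (x + 1 - i%:R)) * f (x + 1 - m%:R)
  = (\prod_(i < m) f (x - i%:R)) * f (x + 1).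
Proof.
elim: m => [|m IH]; first by rewrite !big_ord0 subr0.
rewrite !big_ord_recr /= [in RHS]mulrAC -IH -natr1; congr (_ * f _).
by ring.
Qed.

Definition lin1 (x : rat) : rat := 3 * x + 1.

Lemma lin1_neq0 (a b : nat) : lin1 (a%:R - b%:R) != 0.
Proof.
apply/eqP => E; have : (3 * a + 1)%:R = (3 * b)%:R :> rat.
  by rewrite natrD !natrM; move: E; rewrite /lin1; lra.
by move/eqP; rewrite eqr_nat => /eqP; lia.
Qed.

Section Closed.
Variables (m r s t u v : nat).
Let n : nat := (3 * m + r)%N.
Let z : rat := ff n%:R.
Hypothesis m0 : (0 < m)%N.
Hypotheses (r3 : (r < 3)%N) (s3 : (s < 3)%N) (t3 : (t < 3)%N).
Hypotheses (rs : r != s) (rst : (r + s = t.+1)%N).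
(* u and v describe how the linear factors of the two products telescope; the
   three residues r = 0, 1, 2 use (s,t,u,v) = (1,0,0,0), (2,2,0,1), (0,1,1,1). *)
Hypothesis uv : forall K : rat, let y := 3 * K in
  (n%:R + (y + t%:R) - 2) * ff (y + s%:R)
     * (lin1 (K - m%:R - u%:R) * lin1 (K + v%:R - 1))
  = (y + s%:R - n%:R) * ff (y + t%:R)
     * (lin1 (K - u%:R) * lin1 (K + m%:R + v%:R - 1)).

Let n3 : 3 <= n%:R :> rat. Proof. by rewrite ler_nat /n; lia. Qed.

(** The quadratic part of the j-th factor of g_t(1) is d at j, that of f_s(1) is d at j + m because
    r + s = t + 1. This shift by m makes the quotient collapse to m values of d. *)
Let d (x : rat) : rat := cq n%:R (n%:R + (3 * x + t%:R) - 2).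

Let d_gt0 x : 0 < d x. Proof. exact: cq_gt0. Qed.

(* The closed form of psum t (- z) k / psum s z k, up to its value at 0. *)
Definition wprod (x : rat) : rat :=
  (\prod_(i < m) lin1 (x - u%:R - i%:R)) * (\prod_(i < m) lin1 (x + v%:R + i%:R))
    / \prod_(i < m) d (x + 1 + i%:R).

Let wprodE (k : nat) : wprod k%:R =
  \prod_(i < m) (lin1 (k%:R - u%:R - i%:R) * lin1 (k%:R + v%:R + i%:R)
                 / d (k%:R + 1 + i%:R)).
Proof. by rewrite /wprod prodf_div -big_split. Qed.

Lemma tends_wprod : tends (fun k => wprod k%:R) 1.
Proof.
apply: tends_ext (fun k _ => esym (wprodE k)) _.
apply: (@tends_prod1 m (fun i k => lin1 (k%:R - u%:R - i%:R)
  * lin1 (k%:R + v%:R + i%:R) / d (k%:R + 1 + i%:R))) => i _.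
apply: tends_ext (@tends_quad n%:R (1 - 3 * u%:R - 3 * i%:R)
   (1 + 3 * v%:R + 3 * i%:R) (2 + 3 * i%:R + t%:R) _).
  move=> k _; rewrite /d /lin1; congr (_ * _ / cq _ _); ring.
by rewrite -addrA lerDl addr_ge0 // mulr_ge0.
Qed.

Lemma wprod_neq0 k : wprod k%:R != 0.
Proof.
rewrite wprodE; apply/prodf_neq0 => i _.
rewrite !mulf_neq0 ?invr_eq0 ?(gt_eqF (d_gt0 _)) //.
  have := lin1_neq0 k (u + i); rewrite natrD opprD addrA; exact.
by have := lin1_neq0 (k + v + i) 0; rewrite subr0 !natrD.
Qed.

Let fac_s j : (0 < j)%N -> 1 - z / ff (expo s j)
  = (expo s j - n%:R) * d (j%:R + m%:R) / ff (expo s j).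
Proof.
move=> j0; have nz := ff_expo_neq0 s j0.
rewrite -{1}(divff nz) -mulrBl ffB /d; congr (_ * cq _ _ / _).
rewrite /expo /n natrD natrM.
have -> : (r%:R : rat) = t%:R + 1 - s%:R by rewrite natr1 -rst natrD; ring.
by ring.
Qed.

Let fac_t j : (0 < j)%N -> 1 - (- z) / ff (expo t j)
  = (n%:R + expo t j - 2) * d j%:R / ff (expo t j).
Proof.
move=> j0; have nz := ff_expo_neq0 t j0.
by rewrite mulNr opprK -{1}(divff nz) -mulrDl addrC ffD.
Qed.

(** n is congruent to r modulo 3 and the exponents of f_s to s, so f_s does not terminate. *)
Let expo_neq j : expo s j - n%:R != 0.
Proof.
rewrite subr_eq0 /expo -natrM -natrD eqr_nat.
by apply: contra rs => /eqP; rewrite /n; lia.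
Qed.

Lemma psum_s_neq0 k : psum s z k != 0.
Proof.
elim: k => [|k IH]; first by rewrite psum0 oner_neq0.
rewrite psumS fac_s // !mulf_neq0 ?invr_eq0 ?expo_neq ?ff_expo_neq0 //.
by rewrite gt_eqF.
Qed.

Lemma psum_t_neq0 k : psum t (- z) k != 0.
Proof.
elim: k => [|k IH]; first by rewrite psum0 oner_neq0.
rewrite psumS fac_t // !mulf_neq0 ?invr_eq0 ?ff_expo_neq0 ?(gt_eqF (d_gt0 _)) //.
by have := @expo_ge3 t k.+1 isT; move: n3 => h h'; rewrite gt_eqF //; lra.
Qed.

(** From k to k + 1 each of the three windows changes only at its ends: the ends of the d-window are
    the two quadratic factors, and [uv] matches the ends of the linear windows with the remaining
    factors. *)
Let wprodS k : wprod k.+1%:R = wprod k%:R *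
  ((n%:R + expo t k.+1 - 2) * d k.+1%:R / ff (expo t k.+1)
   / ((expo s k.+1 - n%:R) * d (k.+1%:R + m%:R) / ff (expo s k.+1))).
Proof.
have nft := @ff_expo_neq0 t k.+1 isT; have nfs := @ff_expo_neq0 s k.+1 isT.
have ne := expo_neq k.+1.
have nd1 : d k.+1%:R != 0 by rewrite gt_eqF.
have nd2 : d (k.+1%:R + m%:R) != 0 by rewrite gt_eqF.
have E1 := prod_shiftr lin1 (k%:R - u%:R) m.
have E2 := prod_shiftl lin1 (k%:R + v%:R) m.
have E3 := prod_shiftl d k.+1%:R m.
have Euv := uv k.+1%:R.
have n1 : lin1 (k%:R - u%:R + 1 - m%:R) != 0.
  rewrite (_ : _ - _ = (k + 1)%:R - (u + m)%:R) ?lin1_neq0 //.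
  by rewrite !natrD; ring.
have n2 : lin1 (k%:R + v%:R) != 0.
  by have := lin1_neq0 (k + v) 0; rewrite subr0 natrD.
have nD1 : \prod_(i < m) d (k.+1%:R + 1 + i%:R) != 0.
  by apply/prodf_neq0 => i _; rewrite gt_eqF.
have nD0 : \prod_(i < m) d (k.+1%:R + i%:R) != 0.
  by apply/prodf_neq0 => i _; rewrite gt_eqF.
have F1 : \prod_(i < m) lin1 (k.+1%:R - u%:R - i%:R)
    = \prod_(i < m) lin1 (k%:R - u%:R + 1 - i%:R).
  by apply: eq_bigr => i _; rewrite -natr1; congr lin1; ring.
have F2 : \prod_(i < m) lin1 (k.+1%:R + v%:R + i%:R)
    = \prod_(i < m) lin1 (k%:R + v%:R + 1 + i%:R).
  by apply: eq_bigr => i _; rewrite -natr1; congr lin1; ring.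
have F3 : \prod_(i < m) d (k%:R + 1 + i%:R) = \prod_(i < m) d (k.+1%:R + i%:R).
  by apply: eq_bigr => i _; rewrite natr1.
rewrite /wprod F1 F2 F3 {F1 F2 F3}.
move: E1 E2 E3 n1 n2 nD1 nD0.
have -> : lin1 (k%:R - u%:R + 1) = lin1 (k.+1%:R - u%:R).
  by rewrite -natr1; congr lin1; ring.
have -> : lin1 (k%:R - u%:R + 1 - m%:R) = lin1 (k.+1%:R - m%:R - u%:R).
  by rewrite -natr1; congr lin1; ring.
have -> : lin1 (k%:R + v%:R) = lin1 (k.+1%:R + v%:R - 1).
  by rewrite -natr1; congr lin1; ring.
have -> : lin1 (k%:R + v%:R + m%:R) = lin1 (k.+1%:R + m%:R + v%:R - 1).
  by rewrite -natr1; congr lin1; ring.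
move: Euv; rewrite /= -!/(expo _ _).
move: nft nfs ne nd1 nd2.
set ft := ff _; set fs := ff _; set e := _ - n%:R; set a := _ - 2.
set d1 := d _; set d2 := d (_ + _).
set l1m := lin1 _; set l2 := lin1 _; set l1 := lin1 _; set l2m := lin1 _.
set P1' := \prod_(i < m) _; set P1 := \prod_(i < m) _.
set P2' := \prod_(i < m) _; set P2 := \prod_(i < m) _.
set D' := \prod_(i < m) _; set D := \prod_(i < m) _.
clearbody ft fs e a d1 d2 l1m l2 l1 l2m P1' P1 P2' P2 D' D.
move=> nft nfs ne nd1 nd2 Euv E1 E2 E3 n1 n2 nD' nD.
have -> : P1' = P1 * l1 / l1m by rewrite -E1 mulfK.
have -> : P2' = P2 * l2m / l2 by rewrite -E2 mulfK.
have -> : D' = D * d2 / d1 by rewrite -E3 mulfK.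
have -> : P1 * l1 / l1m * (P2 * l2m / l2) = P1 * P2 * ((l1 * l2m) / (l1m * l2)).
  by field; rewrite n1 n2.
have -> : l1 * l2m / (l1m * l2) = a * fs / (e * ft).
  apply/eqP; rewrite eqr_div ?mulf_neq0 //; apply/eqP.
  by rewrite Euv; ring.
by field; rewrite nd1 nd2 nD nft nfs ne.
Qed.

Lemma psum_quot k : psum t (- z) k / psum s z k * wprod 0 = wprod k%:R.
Proof.
elim: k => [|k IH]; first by rewrite !psum0 divff ?oner_neq0 // mul1r.
rewrite wprodS -IH !psumS fac_s // fac_t //.
by move: (_ / ff (expo s _)) (_ / ff (expo t _)) => Y X; rewrite invfM; ring.
Qed.

(** As [wprod] tends to 1, the quotient g_t(1) / f_s(1) is the inverse of [wprod 0]. *)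
Lemma sum_psum_closed :
  (s%:R - r%:R) / wprod 0 = 3 * \sum_(l < m) psum r z l.
Proof.
apply: (sum_psum_limit r3 s3 t3 rst _ psum_s_neq0 psum_t_neq0).
  (* f_r vanishes at 1: the factor of index m has exponent exactly n, where [ff] equals z. *)
  rewrite -(prednK m0) psumS prednK // /z.
  have en : expo r m = n%:R by rewrite /expo /n natrD natrM.
  by rewrite en divff ?subrr ?mulr0 // -en ff_expo_neq0.
rewrite -[_^-1]mul1r.
apply: tends_ext (tendsM tends_wprod (tends_cst (wprod 0)^-1)) => k _.
by rewrite -psum_quot mulfK // (wprod_neq0 0).
Qed.
End Closed.

(** * Rearranging the finite products *)

Lemma prod_multiples_3 (F : nat -> rat) m r : (r < 3)%N -> (0 < m)%N ->
  \prod_(3 <= j < (3 * m + r - 3).+1 | (3 %| j)%N) F j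
  = \prod_(1 <= i < m) F (3 * i)%N.
Proof.
move=> r3 m0; rewrite -big_filter -[RHS](big_map _ predT).
apply: perm_big; apply: uniq_perm.
- by rewrite filter_uniq // iota_uniq.
- by rewrite map_inj_uniq ?iota_uniq // => i j; lia.
move=> x; rewrite mem_filter mem_index_iota; apply/idP/mapP => [h|[i]].
  by exists (x %/ 3)%N; rewrite ?mem_index_iota; lia.
by rewrite mem_index_iota => h ->; lia.
Qed.

(* The reflection j |-> 3n - 3 - j moves the factors with j = 2 mod 3 to
   positions congruent to 1 mod 3 in the upper half of the range. *)
Lemma prod_nonmultiples_3 (F : nat -> rat) m r t :
  let n := (3 * m + r)%N in
  (r < 3)%N -> (t < 3)%N -> (0 < m)%N -> ((r + t) %% 3 = 0)%N ->
  (forall j, (j <= 3 * n - 3)%N -> F (3 * n - 3 - j)%N = F j) ->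
  \prod_(n.+1 <= j < ((3 * n) %/ 2 - 2).+1 | ~~ (3 %| j)%N) F j
  = \prod_(i < m.-1) F (n + t + 1 + 3 * i)%N.
Proof.
move=> n r3 t3 m0 rt symF.
pose phi j := if (j %% 3 == 2)%N then (3 * n - 3 - j)%N else j.
rewrite -big_filter big_seq_cond.
transitivity (\prod_(j <- [seq j <- index_iota n.+1 ((3 * n) %/ 2 - 2).+1 | ~~ (3 %| j)%N])
   F (phi j)).
  rewrite [RHS]big_seq_cond; apply: eq_bigr => j.
  rewrite mem_filter mem_index_iota andbT => h.
  by rewrite /phi; case: ifP => // _; rewrite symF //; lia.
rewrite -(big_map phi predT F).
rewrite -(big_mkord predT (fun i => F (n + t + 1 + 3 * i)%N)).
rewrite -[RHS](big_map (fun i => n + t + 1 + 3 * i)%N predT F).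
apply: perm_big; apply: uniq_perm.
- rewrite map_inj_in_uniq ?filter_uniq ?iota_uniq // => i j.
  rewrite !mem_filter !mem_index_iota /phi => hi hj.
  by case: ifP => a; case: ifP => b; lia.
- by rewrite map_inj_uniq ?iota_uniq // => i j; lia.
move=> x; apply/mapP/mapP => [[j]|[i]].
  rewrite mem_filter mem_index_iota /phi => h ->.
  case: ifP => a.
    by exists ((3 * n - 3 - j - (n + t + 1)) %/ 3)%N; rewrite ?mem_index_iota; lia.
  by exists ((j - (n + t + 1)) %/ 3)%N; rewrite ?mem_index_iota; lia.
rewrite mem_index_iota => h ->.
have [le|gt] := leqP (n + t + 1 + 3 * i) ((3 * n) %/ 2 - 2).
  exists (n + t + 1 + 3 * i)%N; rewrite ?mem_filter ?mem_index_iota /phi; first by lia.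
  by case: ifP => a; lia.
exists (3 * n - 3 - (n + t + 1 + 3 * i))%N; rewrite ?mem_filter ?mem_index_iota /phi.
  by lia.
by case: ifP => a; lia.
Qed.

(** * From the series back to the stated identity *)

Section Assembly.
Variables (m r : nat).
Let n : nat := (3 * m + r)%N.
Let z : rat := ff n%:R.
Hypothesis m0 : (0 < m)%N.

Let n3 : 3 <= n%:R :> rat. Proof. by rewrite ler_nat /n; lia. Qed.

Let ff_expoB j : (j < m)%N ->
  ff (expo r j) - z = - (3 * (m - j)%:R * cq n%:R (3 * (m - j))%:R).
Proof.
move=> jm; rewrite ffB -cq_sym -mulNr natrM natrB 1?ltnW //.
congr (_ * cq _ _); rewrite /expo /n natrD natrM; ring.
Qed.

Let ff_expoB_neq0 j : (j < m)%N -> ff (expo r j) - z != 0.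
Proof.
move=> jm; rewrite ff_expoB // oppr_eq0 !mulf_neq0 ?(gt_eqF (cq_gt0 _ _)) //.
by rewrite pnatr_eq0 subn_eq0 -ltnNge.
Qed.

(** Descending from m - 1 divides by factors (ff e - z) / ff e with e = n - 3 j; their inverses are
    the factors on the left-hand side of the theorem. *)
Lemma psum_rev i : (i < m)%N ->
  psum r z (m.-1 - i) = psum r z m.-1 *
   \prod_(1 <= j < i.+1) (ff (n%:R - 3 * j%:R) / (ff (n%:R - 3 * j%:R) - z)).
Proof.
elim: i => [|i IH] im; first by rewrite subn0 big_geq // mulr1.
rewrite big_nat_recr //= mulrA -IH 1?ltnW //.
have -> : (m.-1 - i = (m.-1 - i.+1).+1)%N by lia.
set k := (m.-1 - i.+1)%N.
have -> : n%:R - 3 * i.+1%:R = expo r k.+1.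
  rewrite /expo /n natrD natrM (_ : m = (k.+1 + i.+1)%N); last by lia.
  by rewrite natrD; ring.
have nz := @ff_expoB_neq0 k.+1 _; have nzf := @ff_expo_neq0 r k.+1 isT.
by rewrite psumS; field; rewrite nzf nz //; lia.
Qed.

Lemma sum_prod_psum :
  psum r z m.-1 * \sum_(0 <= i < (m - 1).+1)
     \prod_(1 <= j < i.+1)
        (- binom3 (n%:Z - 3 * j%:Z) / (binom3 n%:Z - binom3 (n%:Z - 3 * j%:Z)))
  = \sum_(l < m) psum r z l.
Proof.
have ratio (a b : rat) : - (a / 6) / (b / 6 - a / 6) = a / (a - b).
  (* For a = b both quotients have denominator 0 and hence value 0. *)
  have [->|ab] := eqVneq a b; first by rewrite !subrr invr0 !mulr0.
  by field; rewrite !subr_eq0 ab eq_sym ab.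
rewrite subn1 prednK // big_mkord mulr_sumr [RHS](reindex_inj rev_ord_inj) /=.
apply: eq_bigr => i _.
have -> : (m - i.+1 = m.-1 - i)%N by lia.
rewrite psum_rev //; congr (_ * _); apply: eq_bigr => j _.
by rewrite /binom3 -!/(ff _) ratio rmorphB rmorphM.
Qed.

(** Source of the denominator of the theorem: under j -> m - j the numerators [ff (expo r j) - z]
    become - 3i times c_(3i). *)
Lemma psum_pred :
  psum r z m.-1 * \prod_(1 <= j < m) ff (expo r j)
  = \prod_(1 <= i < m) (- (3 * i%:R)) * \prod_(1 <= i < m) cq n%:R (3 * i)%:R.
Proof.
rewrite /psum prednK // -!big_split /= [RHS]big_nat_rev /=.
apply: eq_big_nat => j /andP[j1 jm].
rewrite add1n subSS mulNr -ff_expoB // mulrBl mul1r divfK // ff_expo_neq0 //.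
Qed.

End Assembly.

(** Used with g the [end_factor], f the values [ff (expo r j)] and l1, l2 the linear factors of
    [wprod 0]: everything that is not some c_j of the statement reduces to the factor m. *)
Lemma prod_const (g f l1 l2 : nat -> rat) :
  g 1%N = 3 * (l1 0%N * l2 0%N) ->
  (forall m, g m.+1 * f m = g m * - (3 * m.+1%:R) * (l1 m * l2 m)) ->
  forall m, (0 < m)%N ->
  g m * \prod_(1 <= j < m) f j
  = 3 * m%:R * \prod_(1 <= i < m) (- (3 * i%:R))
    * (\prod_(i < m) l1 i * \prod_(i < m) l2 i).
Proof.
move=> g1 gS; case=> // m _; elim: m => [|m IH].
  by rewrite !big_geq // !big_ord1 g1; ring.
rewrite !(big_nat_recr m.+1) //= ![\prod_(i < m.+2) _]big_ord_recr /=.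
rewrite mulrCA mulrC gS.
transitivity (g m.+1 * \prod_(1 <= j < m.+1) f j
  * - (3 * m.+2%:R) * (l1 m.+1 * l2 m.+1)); first by ring.
by rewrite IH; ring.
Qed.

(* At x = m this is s - r times the last factor of the denominator of wprod 0, the
   one which does not occur in the statement. *)
Definition end_factor (r s t : nat) (x : rat) : rat :=
  (s%:R - r%:R) * cq (3 * x + r%:R) (6 * x + r%:R + t%:R - 2).

(** The argument common to all residues r; what depends on r is isolated in three polynomial
    identities. *)
Lemma sum_prod_case m r s t u v (n := (3 * m + r)%N) :
  (0 < m)%N -> (r < 3)%N -> (s < 3)%N -> (t < 3)%N -> r != s ->
  (r + s = t.+1)%N -> ((r + t) %% 3 = 0)%N ->
  (forall K : rat, let y := 3 * K in
     (n%:R + (y + t%:R) - 2) * ff (y + s%:R)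
       * (lin1 (K - m%:R - u%:R) * lin1 (K + v%:R - 1))
     = (y + s%:R - n%:R) * ff (y + t%:R)
       * (lin1 (K - u%:R) * lin1 (K + m%:R + v%:R - 1))) ->
  end_factor r s t 1 = 3 * (lin1 (0 - u%:R - 0) * lin1 (0 + v%:R + 0)) ->
  (forall K : rat, end_factor r s t (K + 1) * ff (3 * K + r%:R)
     = end_factor r s t K * - (3 * (K + 1))
       * (lin1 (0 - u%:R - K) * lin1 (0 + v%:R + K))) ->
  \sum_(0 <= i < (m - 1).+1)
     \prod_(1 <= j < i.+1)
        (- binom3 (n%:Z - 3 * j%:Z) / (binom3 n%:Z - binom3 (n%:Z - 3 * j%:Z)))
  = m%:R
    * ((\prod_(n.+1 <= j < ((3 * n) %/ 2 - 2).+1 | ~~ (3 %| j)%N) (c n%:Z j%:Z)%:Q)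
       / (\prod_(3 <= j < (n - 3).+1 | (3 %| j)%N) (c n%:Z j%:Z)%:Q)).
Proof.
move=> m0 r3 s3 t3 rs rst rt uv const1 constS.
have constS' (k : nat) : end_factor r s t k.+1%:R * ff (expo r k)
    = end_factor r s t k%:R * - (3 * k.+1%:R)
      * (lin1 (0 - u%:R - k%:R) * lin1 (0 + v%:R + k%:R)).
  by rewrite -natr1 constS.
have := prod_const (g := fun k => end_factor r s t k%:R) const1 constS' m0.
rewrite /end_factor.
have -> : 6 * m%:R + r%:R + t%:R - 2 = n%:R + (3 * m%:R + t%:R) - 2 :> rat.
  by rewrite /n natrD natrM; ring.
have -> : 3 * m%:R + r%:R = n%:R :> rat by rewrite /n natrD natrM.
move=> const.
have n3 : 3 <= n%:R :> rat by rewrite ler_nat /n; lia.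
have cqR (j : nat) : (c n%:Z j%:Z)%:Q = cq n%:R j%:R by rewrite cqE -!pmulrn.
rewrite (prod_nonmultiples_3 r3 t3 m0 rt) => [|j hj]; last first.
  rewrite !cqR -[RHS]cq_sym; congr cq.
  by rewrite natrB // natrB ?natrM // /n; lia.
rewrite prod_multiples_3 // -/n.
rewrite (eq_bigr (fun i : 'I_m.-1 => cq n%:R (n + t + 1 + 3 * i)%:R)) //.
rewrite [X in _ / X](eq_bigr (fun i => cq n%:R (3 * i)%:R)) //.
have G := @sum_prod_psum m r m0.
have := @sum_psum_closed m r s t u v m0 r3 s3 t3 rs rst uv.
rewrite -G /wprod -/n => {G}.
have := @psum_pred m r m0; rewrite -/n.
have -> : \prod_(i < m) cq n%:R (n%:R + (3 * (0 + 1 + i%:R) + t%:R) - 2)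
    = \prod_(i < m.-1) cq n%:R (n + t + 1 + 3 * i)%:R
      * cq n%:R (n%:R + (3 * m%:R + t%:R) - 2).
  have mE : m%:R = m.-1%:R + 1 :> rat by rewrite natr1 prednK.
  have recr (f : nat -> rat) :
      \prod_(i < m) f i = \prod_(i < m.-1) f i * f m.-1.
    by rewrite -[in LHS](prednK m0) big_ord_recr.
  rewrite (recr (fun i => cq n%:R (n%:R + (3 * (0 + 1 + i%:R) + t%:R) - 2))).
  rewrite mE; congr (_ * _); last first.
    by congr cq; ring.
  by apply: eq_bigr => i _; congr cq; rewrite !natrD; ring.
have nL : \prod_(i < m) lin1 (0 - u%:R - i%:R) * \prod_(i < m) lin1 (0 + v%:R + i%:R) != 0.
  rewrite mulf_neq0 //; apply/prodf_neq0 => i _.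
    by have := lin1_neq0 0 (u + i); rewrite natrD opprD addrA.
  by have := lin1_neq0 (v + i) 0; rewrite subr0 add0r natrD.
have nY : \prod_(1 <= i < m) - (3 * i%:R) != 0 :> rat.
  rewrite prodf_seq_neq0; apply/allP => i; rewrite mem_index_iota => h.
  by rewrite implyTb oppr_eq0 mulf_neq0 // pnatr_eq0; lia.
have nD : \prod_(1 <= i < m) cq n%:R (3 * i)%:R != 0.
  by rewrite prodf_seq_neq0; apply/allP => i _; rewrite implyTb gt_eqF // cq_gt0.
have nd : cq n%:R (n%:R + (3 * m%:R + t%:R) - 2) != 0 by rewrite gt_eqF // cq_gt0.
have nC : \prod_(i < m.-1) cq n%:R (n + t + 1 + 3 * i)%:R != 0.
  by apply/prodf_neq0 => i _; rewrite gt_eqF // cq_gt0.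
move: const nL nY nD nd nC.
set LL := \prod_(i < m) lin1 _ * \prod_(i < m) lin1 _; set Y := \prod_(1 <= i < m) - _.
set D := \prod_(1 <= i < m) cq _ _; set X := \prod_(1 <= j < m) ff _.
set C := \prod_(i < m.-1) _; set dm := cq _ _; set ps := psum _ _ _.
set S := \sum_(0 <= i < _) _; clearbody LL Y D X C dm ps S.
move=> const nL nY nD nd nC EX ES.
(* S is solved for from [EX]: ps X = Y D, [ES]: (s - r) C dm / LL = 3 ps S, and [const]: (s - r) dm
   X = 3 m Y LL, which give S = m C / D. *)
apply: (mulfI (_ : 3 * LL * Y * D != 0)); first by rewrite !mulf_neq0 //.
transitivity (3 * LL * S * (Y * D)); first by ring.
rewrite -EX; transitivity (3 * (ps * S) * LL * X); first by ring.
rewrite -ES invf_div; transitivity ((s%:R - r%:R) * dm * X * C).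
  by field.
by rewrite const; field.
Qed.

Theorem theorem1 (n : nat) (hn : (3 <= n)%N) :
  \sum_(0 <= i < (n %/ 3 - 1).+1)
     \prod_(1 <= j < i.+1)
        (- binom3 (n%:Z - 3 * j%:Z)
           / (binom3 n%:Z - binom3 (n%:Z - 3 * j%:Z)))
  = (n %/ 3)%:R
    * ((\prod_(n.+1 <= j < ((3 * n) %/ 2 - 2).+1 | ~~ (3 %| j)%N) (c n%:Z j%:Z)%:Q)
       / (\prod_(3 <= j < (n - 3).+1 | (3 %| j)%N) (c n%:Z j%:Z)%:Q)) :> rat.
Proof.
have [m [r [nE r3 m0]]] : exists m r, [/\ n = (3 * m + r)%N, (r < 3)%N & (0 < m)%N].
  by exists (n %/ 3)%N, (n %% 3)%N; split; lia.
have -> : (n %/ 3 = m)%N by lia.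
(* The reflection forces t to be -r modulo 3, and then s = t + 1 - r. *)
rewrite {}nE {n hn}; case: r r3 => [|[|[|//]]] _.
- apply: (@sum_prod_case m 0 1 0 0 0) => // K.
  + by rewrite natrD natrM /ff /lin1 /=; ring.
  + by rewrite /end_factor /cq /lin1 /ff; ring.
- apply: (@sum_prod_case m 1 2 2 0 1) => // K.
  + by rewrite natrD natrM /ff /lin1 /=; ring.
  + by rewrite /end_factor /cq /lin1 /ff; ring.
- apply: (@sum_prod_case m 2 0 1 1 1) => // K.
  + by rewrite natrD natrM /ff /lin1 /=; ring.
  + by rewrite /end_factor /cq /lin1 /ff; ring.
Qed.
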